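(* Consider the monoplex path network $G_{Pa}$ and the duplex repeated path network $\mathcal{G}_R$ for $N$ agents with $u_i=u\in\{\mathrm{OR},\mathrm{AND}\}$ for every agent $i$. Then, for any $N$ and any agent $j$, $$\mathcal{C}_j^{G_{Pa}}=h_j(0.5),\qquad \mathcal{C}_j^{\mathcal{G}_R,\mathrm{OR}}=h_j(0.75),\qquad \mathcal{C}_j^{\mathcal{G}_R,\mathrm{AND}}=h_j(0.25),$$ where $$h_j(p_0)=\begin{cases}\sum_{l=0}^{N-2}p_0^l+p_0^{N-2}, & j\in\{1,N\},\\ 1+\sum_{l=0}^{N-3}p_0^l+p_0^{N-3}, & j\in\{2,N-1\},\\ \sum_{l=0}^{j-2}p_0^l+p_0^{j-2}+\sum_{l=1}^{N-j-1}p_0^l+p_0^{N-j-1}, & \text{otherwise}.\end{cases}$$ Moreover, $$\mathcal{C}_j^{\mathcal{G}_R,\mathrm{OR}}>\mathcal{C}_j^{G_{Pa}}>\mathcal{C}_j^{\mathcal{G}_R,\mathrm{AND}}.$$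
   Context: Networks: $G_{Pa}$ is the undirected, unweighted path $1-2-\cdots-N$ (a single layer). $\mathcal{G}_R$ has two layers, each equal to $G_{Pa}$. Every undirected edge is modeled by two opposing directed edges, and each directed edge $e^k_{i,j}$ from $i$ to $j$ in layer $k$ (agent $i$ senses agent $j$) has weight $w^k_{i,j}=1/d_i^k$, where $d_i^k=|N_i^k|$ and $N_i^k$ is the set of out-neighbors of $i$ in layer $k$. Multiplex linear threshold model (LTM) on a network with $m$ layers: thresholds $\mu_i^k$ are drawn independently from the uniform distribution on $(0,1)$ for each agent $i$ and layer $k$. $x_i(t)\in\{0,1\}$ is the state of agent $i$ at iteration $t$, $S_t=\{i:x_i(t)=1\}$, and initially $x_i(0)=1$ iff $i\in S_0$, where $S_0$ is the set of initially active agents. For $t\ge 1$ let $y_i^k(t)=1$ if $\mu_i^k<\sum_{j\in N_i^k\cap S_{t-1}}w^k_{i,j}$ and $y_i^k(t)=0$ otherwise. Agent $i$ uses a protocol $u_i\in\{\mathrm{OR},\mathrm{AND}\}$: $x_i(t)=1$ if $x_i(t-1)=1$, or if $u_i=\mathrm{OR}$ and $y_i^k(t)=1$ for at least one layer $k$, or if $u_i=\mathrm{AND}$ and $y_i^k(t)=1$ for all layers $k$; otherwise $x_i(t)=0$. The monoplex LTM is the case $m=1$, where the two protocols coincide. $\bar x_i=\lim_{t\to\infty}x_i(t)$. Cascade centrality of agent $j$: the expected number $\mathbb{E}\big(\sum_i\bar x_i\big)$ of agents active at steady state when $S_0=\{j\}$; it is written $\mathcal{C}_j^{G}$ for a monoplex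 network $G$ and $\mathcal{C}_j^{\mathcal{G},u}$ for a multiplex network $\mathcal{G}$ in which all agents use protocol $u$.
   Formalization: N ≥ 2 is assumed, since for N = 1 the centrality is 1 while h_1 is not; the strict inequalities are stated only for N ≥ 3 and not (N = 3, j = 2), since for N = 2 all three centralities equal 2 and for N = 3, j = 2 all equal 3. *)

(* Defs.v *)
From HB Require Import structures.
From mathcomp Require Export all_boot all_order all_algebra.
From mathcomp Require Export all_classical all_reals all_analysis.

Set Implicit Arguments.
Unset Strict Implicit.
Unset Printing Implicit Defensive.

Import Order.TTheory GRing.Theory Num.Theory.
Import numFieldNormedType.Exports.

Local Open Scope classical_set_scope.
Local Open Scope ring_scope.

(** Agents are the elements of ['I_N]: the ordinal [j] is the agent written
    [j.+1] when agents are numbered from 1 to [N]. *)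

(** [G k i j] holds iff layer [k] contains the directed edge from [i] to [j],
    i.e. iff agent [i] senses agent [j] in layer [k]. *)
Definition network (m N : nat) := 'I_m -> rel 'I_N.

Definition out_nbrs m N (G : network m N) (k : 'I_m) (i : 'I_N) : {set 'I_N} :=
  finset (G k i).

Definition degree m N (G : network m N) (k : 'I_m) (i : 'I_N) : nat :=
  #|out_nbrs G k i|.

Definition weight (R : realType) m N (G : network m N) (k : 'I_m)
    (i j : 'I_N) : R :=
  (degree G k i)%:R^-1.

Definition path_edge (N : nat) : rel 'I_N :=
  fun i j => (i.+1 == j :> nat) || (j.+1 == i :> nat).

Definition repeated_path (m N : nat) : network m N := fun=> @path_edge N.
Arguments repeated_path : clear implicits.

Definition path_monoplex (N : nat) : network 1 N := repeated_path 1 N.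
Arguments path_monoplex : clear implicits.

Definition repeated_path_duplex (N : nat) : network 2 N := repeated_path 2 N.
Arguments repeated_path_duplex : clear implicits.

Inductive protocol := OR | AND.

Section threshold_model.
Context (R : realType) (m N : nat).
Variables (G : network m N) (u : 'I_N -> protocol) (thr : 'I_N -> 'I_m -> R).

(** [y_i^k(t)] as a function of the set [S] of agents active at time [t - 1]. *)
Definition layer_active (S : {set 'I_N}) (i : 'I_N) (k : 'I_m) : bool :=
  thr i k < \sum_(j in out_nbrs G k i :&: S) weight R G k i j.

Definition protocol_active (S : {set 'I_N}) (i : 'I_N) : bool :=
  match u i with
  | OR => [exists k, layer_active S i k]
  | AND => [forall k, layer_active S i k]
  end.

Fixpoint active_set (S0 : {set 'I_N}) (t : nat) : {set 'I_N} :=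
  if t is t'.+1 then
    let S := active_set S0 t' in finset (fun i => (i \in S) || protocol_active S i)
  else S0.

Definition state (S0 : {set 'I_N}) (t : nat) (i : 'I_N) : R :=
  (i \in active_set S0 t)%:R.

Definition steady_state (S0 : {set 'I_N}) (i : 'I_N) : R :=
  lim (state S0 t i @[t --> \oo]).

End threshold_model.

Section random_thresholds.
Context d (T : measurableType d) (R : realType) (P : probability T R).

Definition mutually_independent (I : finType) (X : I -> {RV P >-> R}) : Prop :=
  forall (J : {set I}) (B : I -> set R),
    (forall i, i \in J -> measurable (B i)) ->
    P (\bigcap_(i in [set` J]) X i @^-1` B i) =
      (\prod_(i in J) P (X i @^-1` B i))%E.

(** The law [uniform_prob ltr01] is given by the density that is 1 on the closed
    interval [[0, 1]]; this is also the uniform law on the open interval. *)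
Definition iid_uniform_thresholds m N (mu : 'I_N -> 'I_m -> {RV P >-> R}) : Prop :=
  mutually_independent (fun ik : 'I_N * 'I_m => mu ik.1 ik.2) /\
  forall i k (A : set R), measurable A ->
    distribution P (mu i k) A = uniform_prob (@ltr01 R) A.

Definition cascade_centrality m N (G : network m N) (u : 'I_N -> protocol)
    (mu : 'I_N -> 'I_m -> {RV P >-> R}) (j : 'I_N) : \bar R :=
  ('E_P[fun w : T => (\sum_(i < N)
     steady_state G u (fun i k => mu i k w) (finset.set1 j) i)%R])%E.

End random_thresholds.

(** [j] is numbered from 1.  The truncated subtractions agree with those of the
    integers in each case as soon as [2 <= N] and [1 <= j <= N]; the upper limits
    of the sums are [N - 2], [N - 3], [j - 2] and [N - j - 1], inclusive. *)
Definition h (R : realType) (N j : nat) (p0 : R) : R :=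
  if (j == 1%N) || (j == N) then
    \sum_(0 <= l < (N - 2).+1) p0 ^+ l + p0 ^+ (N - 2)
  else if (j == 2%N) || (j == N - 1)%N then
    1 + \sum_(0 <= l < (N - 3).+1) p0 ^+ l + p0 ^+ (N - 3)
  else
    \sum_(0 <= l < (j - 2).+1) p0 ^+ l + p0 ^+ (j - 2)
    + \sum_(1 <= l < (N - j - 1).+1) p0 ^+ l + p0 ^+ (N - j - 1).

(* Main.v *)
(** With thresholds in [[0, 1[], activity spreads away from the seed [j] one agent
    at a time on each side.  An end of the path has a single neighbour, of weight
    1, so it always follows that neighbour; an interior agent gives weight 1/2 to
    the neighbour nearer to [j], hence follows it exactly when its protocol accepts
    the set of layers whose threshold is below 1/2.  So [i] ends up active iff all
    interior agents from [j] (excluded) to [i] accept.  These events are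
    independent, of probability 1/2, 3/4 and 1/4 in the three models, so the
    centrality is a sum over [i] of powers of that probability. *)
Require Import Defs.
From mathcomp Require Import measurable_realfun zify ring lra.

Set Implicit Arguments.
Unset Strict Implicit.
Unset Printing Implicit Defensive.

Import Order.TTheory GRing.Theory Num.Theory.
Import numFieldNormedType.Exports.

Local Open Scope classical_set_scope.
Local Open Scope ring_scope.

(** * Protocol responses and neighbour counts on the path *)

Definition responds m (u : protocol) (b : 'I_m -> bool) : bool :=
  match u with OR => [exists k, b k] | AND => [forall k, b k] end.

Lemma responds_mono m (u : protocol) (b c : 'I_m -> bool) :
  (forall k, b k -> c k) -> responds u b -> responds u c.
Proof.
move=> bc; case: u => /=.
  by move=> /existsP[k bk]; apply/existsP; exists k; exact: bc.
by move=> /forallP bk; apply/forallP => k; exact: bc.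
Qed.

(** At least one layer is required: over none, [OR] never responds and [AND] always does. *)
Lemma responds_const m (u : protocol) (b : bool) :
  responds u (fun _ : 'I_m.+1 => b) = b.
Proof.
case: u; case: b => /=.
- by apply/existsP; exists ord0.
- by apply/existsP => -[].
- exact/forallP.
- by apply/forallP => /(_ ord0).
Qed.

(** The interior agents on the path from [j] (excluded) to [i] (included). *)
Definition bottlenecks N (j i : 'I_N) : {set 'I_N} :=
  finset (fun l : 'I_N => (0 < l < N.-1)%N && ((j < l <= i) || (i <= l < j))%N).

Lemma card_ord_itv N a b : (b <= N)%N ->
  #|finset (fun l : 'I_N => a <= l < b)%N| = (b - a)%N.
Proof.
move=> bN; rewrite -sum1dep_card.
transitivity (\sum_(a <= i < N | i < b) 1)%N.
  by rewrite big_geq_mkord; apply: eq_bigl => i; rewrite andbC.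
by rewrite -(big_nat_widen _ _ _ xpredT _ bN) sum_nat_const_nat muln1.
Qed.

Lemma card_ord_pred1 N n : #|finset (fun l : 'I_N => l == n :> nat)| = (n < N)%N.
Proof.
case: ltnP => nN.
  rewrite -[RHS](subSnn n) -(card_ord_itv n nN); apply: eq_card => l.
  by rewrite !inE; lia.
by apply: eq_card0 => l; rewrite !inE; have := ltn_ord l; lia.
Qed.

Lemma card_path_nbrs N (i : 'I_N) :
  #|finset (@path_edge N i)| = ((0 < i) + (i < N.-1))%N.
Proof.
have -> : finset (@path_edge N i) =
    finset (fun l : 'I_N => i.-1 <= l < i)%N :|:
    finset (fun l : 'I_N => l == i.+1 :> nat) :> {set 'I_N}.
  by apply/setP => l; rewrite !inE /path_edge; lia.
rewrite cardsU card_ord_pred1 card_ord_itv; last exact: ltnW.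
rewrite (_ : _ :&: _ = finset.set0); last by apply/setP => l; rewrite !inE; lia.
by rewrite cards0; have := ltn_ord i; lia.
Qed.

(** * Deterministic spread of activity along the path *)

Section path_activation.
Variables (R : realType) (m N : nat) (u : 'I_N -> protocol).
Variables (thr : 'I_N -> 'I_m.+1 -> R) (j : 'I_N).
Hypothesis N_ge2 : (2 <= N)%N.
Hypothesis thr01 : forall i k, 0 <= thr i k < 1.

Let G : network m.+1 N := repeated_path m.+1 N.
Let act := active_set G u thr (finset.set1 j).

Lemma layer_active_pathE (S : {set 'I_N}) i k :
  layer_active G thr S i k =
  (thr i k < #|finset (@path_edge N i) :&: S|%:R / ((0 < i) + (i < N.-1))%:R).
Proof.
rewrite /layer_active /weight /degree /out_nbrs sumr_const card_path_nbrs.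
by rewrite mulr_natl.
Qed.

Let half_lt i k : bool := thr i k < 1 / 2.

(** Induction on time: an agent other than [j] turns active only next to an active one, and its
    bottlenecks are among those of that neighbour, possibly with itself added. *)
Lemma active_bottlenecks t i : i \in act t ->
  forall l, l \in bottlenecks j i -> responds (u l) (half_lt l).
Proof.
elim: t i => [|t IH] i.
  by rewrite inE => /eqP-> l; rewrite inE; lia.
rewrite /act /= inE -/act => /orP[/IH//|].
have [->|ij] := eqVneq i j; first by move=> _ l; rewrite inE; lia.
have {}ij : i != j :> nat by [].
pose S := act t; rewrite -[act t]/S => acti.
(* Either the neighbour of [i] farther from [j] is already active, and the path to
   it runs through [i], or the nearer neighbour alone triggers [i]. *)
have [/existsP[i' /andP[i'S far]]|nofar] := boolP [exists i' : 'I_N,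
    (i' \in S) && (((j < i)%N && (i' == i.+1 :> nat)) ||
                   ((i < j)%N && (i == i'.+1 :> nat)))].
  move=> l; rewrite inE => il; apply: (IH i' i'S); rewrite inE; lia.
have sub : finset (@path_edge N i) :&: S \subset
    finset (fun l : 'I_N => l == (if j < i then i.-1 else i.+1)%N :> nat).
  apply/fintype.subsetP => i'; rewrite !inE /path_edge => /andP[ii' i'S].
  move: nofar; rewrite negb_exists => /forallP/(_ i'); rewrite i'S /=.
  by case: ifP; lia.
have near : exists2 i', i' \in S & i' = (if j < i then i.-1 else i.+1)%N :> nat.
  have [i' i'I|I0] := pickP (mem (finset (@path_edge N i) :&: S)).
    exists i'; first by move: i'I; rewrite !inE => /andP[].
    by move/fintype.subsetP: sub => /(_ _ i'I); rewrite inE => /eqP.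
  (* With no active neighbour the weighted sum is 0, which exceeds no nonnegative threshold. *)
  have : responds (u i) (layer_active G thr S i) by exact: acti.
  suff -> : layer_active G thr S i = fun=> false by rewrite responds_const.
  apply: funext => k; rewrite layer_active_pathE (eq_card0 I0) mul0r.
  by apply/negbTE; rewrite -leNgt; case/andP: (thr01 i k).
have {near} [i' i'S i'E] := near.
move=> l; have [->|li] := eqVneq l i; last first.
  rewrite inE => il; apply: (IH i' i'S); rewrite inE.
  by move: i'E li; rewrite -val_eqE /=; case: ifP; lia.
rewrite inE => /andP[iint _].
(* At most one of the two neighbours is active, so the sum is at most 1/2 and an active layer has
   its threshold below 1/2. *)
apply: responds_mono acti => k.
rewrite layer_active_pathE => /lt_le_trans; apply.
have -> : ((0 < i) + (i < N.-1))%N = 2%N by lia.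
rewrite ler_pM2r ?invr_gt0// lern1 (leq_trans (subset_leq_card sub))//.
by rewrite card_ord_pred1 leq_b1.
Qed.

(** The two bounds say that [i] and [j] are at distance at most [d]. Induction on [d]: the neighbour
    nearer to [j] is active one iteration earlier, since its bottlenecks are among those of [i]. *)
Lemma bottlenecks_active d (i : 'I_N) : (i <= j + d)%N -> (j <= i + d)%N ->
  (forall l, l \in bottlenecks j i -> responds (u l) (half_lt l)) ->
  i \in act d.
Proof.
elim: d i => [|d IH] i ijd jid resp.
  by rewrite inE; apply/eqP/val_inj => /=; lia.
rewrite /act /= inE -/act.
have [->|ij] := eqVneq i j; first by rewrite IH ?orTb// => [||l]; rewrite ?inE; lia.
have {}ij : i != j :> nat by [].
have i'N : ((if j < i then i.-1 else i.+1) < N)%N.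
  by have := ltn_ord i; have := ltn_ord j; case: ifP; lia.
pose i' := Ordinal i'N.
have i'act : i' \in act d.
  apply: IH => [||l il]; rewrite /=; try by case: ifP; lia.
  by apply: resp; move: il; rewrite !inE /=; case: ifP; lia.
have card_ge1 : (1 <= #|finset (@path_edge N i) :&: act d|)%N.
  apply/card_gt0P; exists i'; rewrite !inE i'act andbT /path_edge /=.
  by case: ifP; lia.
apply/orP; right; rewrite -[protocol_active _ _ _ _ _]/(responds (u i)
  (layer_active G thr (act d) i)).
have [iint|iend] := boolP (0 < i < N.-1)%N.
  have iB : i \in bottlenecks j i by rewrite inE iint /=; lia.
  apply: responds_mono (resp i iB) => k hik.
  rewrite layer_active_pathE (lt_le_trans hik)//.
  have -> : ((0 < i) + (i < N.-1))%N = 2%N by lia.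
  by rewrite ler_pM2r ?invr_gt0// ler1n.
(* An end receives the full weight 1, above every threshold. *)
suff -> : layer_active G thr (act d) i = fun=> true by rewrite responds_const.
apply: funext => k; rewrite layer_active_pathE.
have -> : ((0 < i) + (i < N.-1))%N = 1%N by have := ltn_ord i; lia.
case/andP: (thr01 i k) => _ /lt_le_trans -> //.
by rewrite divr1 ler1n.
Qed.

Lemma ever_activeE i :
  (exists t, i \in act t) <->
  [forall l in bottlenecks j i, responds (u l) (half_lt l)].
Proof.
split=> [[t /active_bottlenecks H]|/forall_inP H]; first exact/forall_inP.
by exists (i + j)%N; apply: bottlenecks_active => //; lia.
Qed.

End path_activation.

(** * Steady states, and the law of the thresholds relative to 1/2 *)

(** Active sets only grow, so each state is eventually constant and [lim] is a genuine limit. *)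
Lemma steady_stateE (R : realType) m N (G : network m N) (u : 'I_N -> protocol)
    (thr : 'I_N -> 'I_m -> R) (S0 : {set 'I_N}) i :
  steady_state G u thr S0 i = `[< exists t, i \in active_set G u thr S0 t >]%:R.
Proof.
have mono t s : i \in active_set G u thr S0 t -> i \in active_set G u thr S0 (s + t).
  by move=> it; elim: s => //= s IH; rewrite inE IH.
rewrite /steady_state; apply: lim_near_cst => //.
case: asboolP => [[t it]|nt].
  near=> s; rewrite /state -(@subnK t s) ?mono//; near: s; exact: nbhs_infty_ge.
apply: nearW => s; rewrite /state.
by case: (boolP (i \in _)) => // si; exfalso; apply: nt; exists s.
Unshelve. all: by end_near.
Qed.

(** [A] is only known up to the null set missed by the cells, on which thresholds
    may lie outside [[0, 1[]. *)
Lemma probability_partition d (T : measurableType d) (R : realType)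
    (P : probability T R) (I : finType) (C : I -> set T) (q : I -> R)
    (Q : pred I) (A : set T) :
  measurable A -> (forall c, measurable (C c)) -> trivIset [set: I] C ->
  (forall c, P (C c) = (q c)%:E) -> \sum_c q c = 1 ->
  (forall c, Q c -> C c `<=` A) -> (forall c, ~~ Q c -> C c `<=` ~` A) ->
  P A = (\sum_(c | Q c) q c)%:E.
Proof.
move=> mA mC tC PC q1 CA CnA.
have sum_le (Q' : pred I) (B : set T) : measurable B ->
    (forall c, Q' c -> C c `<=` B) -> ((\sum_(c | Q' c) q c)%:E <= P B)%E.
  move=> mB CB; rewrite -sumEFin -big_enum.
  under eq_bigr do rewrite -PC.
  have tQ' : trivIset [set` enum Q'] C by exact: sub_trivIset tC.
  rewrite (fsbig_seq _ _ (enum_uniq Q')) -measure_fin_bigcup//.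
  rewrite le_measure ?inE//; first exact: fin_bigcup_measurable.
  by move=> w [c /=]; rewrite mem_enum => Qc; exact: CB.
(* The lower bounds for [A] and for its complement add up to 1, so both are equalities. *)
have := sum_le _ _ mA CA.
have := sum_le _ _ (measurableC mA) CnA.
rewrite probability_setC// -(fineK (fin_num_measure P _ mA)) -EFinB !lee_fin.
move: q1; rewrite (bigID Q)/= => q1 h1 h2; congr EFin; lra.
Qed.

(** Closed on the left, so that the strict test [x < 1 / 2] separates the halves and the value 1,
    which would block an end agent, is excluded. *)
Definition half_interval (R : realType) (b : bool) : set R :=
  [set` if b then `[0, 1 / 2[ else `[1 / 2, 1[ : interval R].
Arguments half_interval : clear implicits.

Lemma measurable_half_interval (R : realType) b : measurable (half_interval R b).
Proof. by case: b; exact: measurable_itv. Qed.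

Lemma half_interval_sub (R : realType) b x : half_interval R b x -> 0 <= x < 1.
Proof. by case: b; rewrite /half_interval /= in_itv /=; lra. Qed.

Lemma half_intervalE (R : realType) b x : half_interval R b x -> (x < 1 / 2) = b.
Proof.
case: b; rewrite /half_interval /= in_itv /= => /andP[// h _].
by apply/negbTE; rewrite -leNgt.
Qed.

Lemma uniform_prob_half_interval (R : realType) b :
  uniform_prob (@ltr01 R) (half_interval R b) = (1 / 2)%:E.
Proof.
rewrite /uniform_prob integral_uniform_pdf setIidl; last first.
  by move=> x /half_interval_sub; rewrite /= in_itv /=; lra.
rewrite (eq_integral (cst 1%E)); last first.
  move=> x; rewrite inE => /half_interval_sub x01.
  by rewrite /uniform_pdf ifT ?subr0 ?invr1//; lra.
rewrite integral_cst; last exact: measurable_half_interval.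
rewrite mul1e /half_interval; case: b => /=; rewrite lebesgue_measure_itv /= lte_fin.
  by rewrite ifT; [rewrite -EFinB; congr EFin; lra|lra].
by rewrite ifT; [rewrite -EFinB; congr EFin; lra|lra].
Qed.

Section law_of_halves.
Context d (T : measurableType d) (R : realType) (P : probability T R).
Variables (m N : nat) (mu : 'I_N -> 'I_m -> {RV P >-> R}).
Hypothesis iid_mu : iid_uniform_thresholds mu.

(** A cell records which thresholds lie below 1/2. The curried [c] lets sums over cells factor agent
    by agent. *)
Definition cell (c : {ffun 'I_N -> {ffun 'I_m -> bool}}) : set T :=
  \bigcap_(ik in [set` [set: 'I_N * 'I_m]%SET])
    mu ik.1 ik.2 @^-1` half_interval R (c ik.1 ik.2).

Lemma cell_thr c w i k : cell c w -> half_interval R (c i k) (mu i k w).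
Proof. by move=> /(_ (i, k)); apply; rewrite /= inE. Qed.

Lemma measurable_cell c : measurable (cell c).
Proof.
apply: fin_bigcap_measurable => // -[i k] _; rewrite -[X in measurable X]setTI.
by apply: measurable_funPT => //; exact: measurable_half_interval.
Qed.

Lemma trivIset_cell : trivIset setT cell.
Proof.
move=> b c _ _ [w [wb wc]]; apply/ffunP => i; apply/ffunP => k.
by rewrite -(half_intervalE (cell_thr i k wb)) (half_intervalE (cell_thr i k wc)).
Qed.

(** Kept as a product over agents, the shape needed to exchange sum and product later. *)
Lemma probability_cell c : P (cell c) = (\prod_(i < N) (1 / 2) ^+ m)%:E.
Proof.
case: iid_mu => indep unif.
rewrite /cell (indep _ (fun ik => half_interval R (c ik.1 ik.2))); last first.
  by move=> ik _; exact: measurable_half_interval.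
rewrite (eq_bigr (fun=> (1 / 2)%:E)); last first.
  move=> [i k] _ /=; rewrite -[LHS]/(distribution P (mu i k) _).
  by rewrite unif ?uniform_prob_half_interval//; exact: measurable_half_interval.
rewrite prodEFin prodr_const cardsT card_prod !card_ord prodr_const card_ord.
by rewrite -exprM mulnC.
Qed.

End law_of_halves.

(** * Probability that one agent responds *)

(** Among [m] independent fair coins, the chance of some success, respectively of only successes. *)
Definition response_prob (R : realType) m (u : protocol) : R :=
  match u with OR => 1 - (1 / 2) ^+ m | AND => (1 / 2) ^+ m end.

Lemma sum_half_ffun (R : realType) m :
  \sum_(x : {ffun 'I_m -> bool}) (1 / 2) ^+ m = 1 :> R.
Proof.
rewrite sumr_const card_ffun card_bool card_ord -[LHS]mulr_natl natrX.
by rewrite -exprMn mul1r divff ?expr1n// pnatr_eq0.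
Qed.

(** [AND] accepts only the all-true pattern, and [OR] rejects only the all-false one. *)
Lemma sum_responses (R : realType) m (u : protocol) :
  \sum_(x : {ffun 'I_m -> bool} | responds u x) (1 / 2) ^+ m =
  response_prob R m u.
Proof.
case: u => /=; last first.
  rewrite (big_pred1 [ffun=> true]) // => x /=.
  apply/forallP/eqP => [xT|-> k]; last by rewrite ffunE.
  by apply/ffunP => k; rewrite ffunE; exact: xT.
apply: (addIr ((1 / 2) ^+ m)); rewrite subrK -[RHS](sum_half_ffun R m).
rewrite [RHS](bigID (fun x : {ffun _ -> _} => [exists k, x k])) /=; congr +%R.
rewrite (big_pred1 [ffun=> false]) // => x /=; rewrite negb_exists.
apply/forallP/eqP => [xF|-> k]; last by rewrite ffunE.
by apply/ffunP => k; rewrite ffunE; exact/negbTE.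
Qed.

(** * Measurability, and centrality as a sum of probabilities *)

Lemma measurable_fun_responds d (T : measurableType d) m (u : protocol)
    (f : 'I_m -> T -> bool) :
  (forall k, measurable_fun setT (f k)) ->
  measurable_fun setT (fun w => responds u (f ^~ w)).
Proof.
move=> mf; case: u => /=.
  have -> : (fun w => [exists k, f k w]) = fun w => \big[orb/false]_k f k w.
    by apply: funext => w; rewrite big_orE.
  elim: (index_enum _) => [|k s IH].
    by under eq_fun do rewrite big_nil; exact: measurable_cst.
  by under eq_fun do rewrite big_cons; exact: measurable_or.
have -> : (fun w => [forall k, f k w]) = fun w => \big[andb/true]_k f k w.
  by apply: funext => w; rewrite big_andE.
elim: (index_enum _) => [|k s IH].
  by under eq_fun do rewrite big_nil; exact: measurable_cst.
by under eq_fun do rewrite big_cons; exact: measurable_and.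
Qed.

Section measurability.
Context d (T : measurableType d) (R : realType) (P : probability T R).
Variables (m N : nat) (G : network m N) (u : 'I_N -> protocol).
Variables (mu : 'I_N -> 'I_m -> {RV P >-> R}) (S0 : {set 'I_N}).

Let act t w := active_set G u (fun i k => mu i k w) S0 t.

Lemma measurable_active_set t i : measurable_fun setT (fun w => i \in act t w).
Proof.
rewrite /act; elim: t i => [|t IH] i /=; first exact: measurable_cst.
under eq_fun do rewrite inE.
apply: measurable_or; first exact: IH.
apply: (@measurable_fun_responds _ _ _ (u i) (fun k w =>
  layer_active G (fun i k => mu i k w) (act t w) i k)) => k.
apply: measurable_fun_ltr; first exact: measurable_funPT.
under eq_fun do rewrite big_mkcond /=.
apply: measurable_sum => l.
apply: measurable_fun_ifT => //.
under eq_fun do rewrite inE.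
by apply: measurable_and => //; exact: IH.
Qed.

Lemma measurable_ever_active i : measurable [set w | exists t, i \in act t w].
Proof.
rewrite (_ : [set w | _] = \bigcup_t [set w | i \in act t w]); last first.
  by apply/seteqP; split=> w [t it]; exists t.
apply: bigcup_measurable => t _.
rewrite -[X in measurable X]setTI.
exact: (measurable_active_set t i measurableT (_ : measurable [set true])).
Qed.

(** Each steady state is the indicator of eventual activation; linearity of the integral does the
    rest. *)
Lemma cascade_centrality_sum (j : 'I_N) : S0 = finset.set1 j ->
  cascade_centrality G u mu j =
  (\sum_(i < N) P [set w | exists t, i \in act t w])%E.
Proof.
move=> S0E; rewrite /cascade_centrality expectation.unlock.
rewrite (eq_integral (fun w => (\sum_(i < N)
  (\1_[set w | exists t, i \in act t w] w)%:E)%E)); last first.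
  move=> w _; rewrite sumEFin; congr EFin; apply: eq_bigr => i _.
  by rewrite steady_stateE -S0E indicE.
rewrite ge0_integral_sum//; last first.
- move=> i; apply/measurable_EFinP.
  exact/measurable_indic/measurable_ever_active.
apply: eq_bigr => i _; rewrite integral_indic ?setIT//.
exact: measurable_ever_active.
Qed.

End measurability.

(** * Activation probabilities on the path *)

Section path_centrality.
Context d (T : measurableType d) (R : realType) (P : probability T R).
Variables (m N : nat) (mu : 'I_N -> 'I_m.+1 -> {RV P >-> R}).
Hypotheses (N_ge2 : (2 <= N)%N) (iid_mu : iid_uniform_thresholds mu).
Variable u : 'I_N -> protocol.

(** Each cell decides whether [i] is ever active. The favourable cells constrain agents separately,
    as the family [F], so distributivity turns their sum into a product in which every agent outside
    the bottlenecks contributes 1. *)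
Lemma probability_ever_active i j :
  P [set w | exists t, i \in active_set (repeated_path m.+1 N) u
    (fun i k => mu i k w) (finset.set1 j) t] =
  (\prod_(l in bottlenecks j i) response_prob R m.+1 (u l))%:E.
Proof.
pose F l : pred {ffun 'I_m.+1 -> bool} :=
  fun x => (l \in bottlenecks j i) ==> responds (u l) x.
have F_prob l : \sum_(x | F l x) (1 / 2) ^+ m.+1 =
    if l \in bottlenecks j i then response_prob R m.+1 (u l) else 1.
  case: ifP => lB; rewrite /F lB /=; first exact: sum_responses.
  exact: sum_half_ffun.
rewrite (@probability_partition _ _ _ _ _ (cell mu)
  (fun=> \prod_(i < N) (1 / 2) ^+ m.+1) (fun c => c \in family F)).
- rewrite -(bigA_distr_big_dep F (fun=> fun=> (1 / 2) ^+ m.+1)).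
  by under eq_bigr do rewrite F_prob; rewrite -big_mkcond.
- exact: measurable_ever_active.
- exact: measurable_cell.
- exact: trivIset_cell.
- exact: probability_cell.
- rewrite -(bigA_distr_bigA (fun=> fun=> (1 / 2) ^+ m.+1)) big1// => l _.
  exact: sum_half_ffun.
all: move=> c Fc w cw.
all: have thr01 i' k : 0 <= mu i' k w < 1
  by exact: half_interval_sub (cell_thr i' k cw).
all: have lowE l : (fun k => mu l k w < 1 / 2) = c l
  by apply: funext => k; exact: half_intervalE (cell_thr l k cw).
- apply/(ever_activeE _ _ N_ge2 thr01)/forall_inP => l lB.
  by rewrite lowE; exact: (implyP (familyP Fc l : F l (c l))).
- move=> /(ever_activeE _ _ N_ge2 thr01)/forall_inP resp.
  move/negP: Fc; apply; apply/familyP => l.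
  by apply/implyP => lB; rewrite -lowE; exact: resp.
Qed.

Lemma path_centralityE j :
  cascade_centrality (repeated_path m.+1 N) u mu j =
  (\sum_(i < N) \prod_(l in bottlenecks j i) response_prob R m.+1 (u l))%:E.
Proof.
rewrite (cascade_centrality_sum _ _ _ erefl) -sumEFin.
by apply: eq_bigr => i _; exact: probability_ever_active.
Qed.

End path_centrality.

(** * Closed form of the sum over agents *)

(** Expected number of agents activated on a side of the seed that has [a >= 1]
    agents. *)
Definition one_side (R : pzRingType) (p : R) (a : nat) : R :=
  \sum_(1 <= l < a) p ^+ l + p ^+ (a - 1).

(** The 1 is the seed. On a side of [a] agents, the one at distance [r < a] has [r] bottlenecks and
    the end has [a - 1]. Empty sides are treated apart because [one_side p 0] is 1, not 0. *)
Lemma sum_bottlenecks (R : comPzRingType) N (j : 'I_N) (p : R) : (2 <= N)%N ->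
  \sum_(i < N) p ^+ #|bottlenecks j i| =
  1 + (if j == 0%N :> nat then 0 else one_side p j)
    + (if j == N.-1 :> nat then 0 else one_side p (N.-1 - j)).
Proof.
move=> N_ge2; have jN := ltn_ord j.
(* Here [maxn] and, on the right, [minn] discard the end, which is never a bottleneck. *)
have left_card (i : 'I_N) : (i < j)%N -> #|bottlenecks j i| = (j - maxn i 1)%N.
  move=> ij; rewrite -(card_ord_itv _ (ltnW jN)); apply: eq_card => l.
  by rewrite !inE; lia.
have right_card (i : 'I_N) : (j <= i)%N ->
    #|bottlenecks j i| = (minn i.+1 N.-1 - j.+1)%N.
  move=> ji; rewrite -(@card_ord_itv N); last by have := ltn_ord i; lia.
  by apply: eq_card => l; rewrite !inE; lia.
rewrite (eq_bigr (fun i : 'I_N => p ^+ (if (i < j)%N then j - maxn i 1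
    else minn i.+1 N.-1 - j.+1)%N)); last first.
  by move=> i _; case: ltnP => ij; [rewrite left_card|rewrite right_card].
rewrite -(big_mkord xpredT (fun i => p ^+ (if (i < j)%N then j - maxn i 1
    else minn i.+1 N.-1 - j.+1)%N)).
rewrite (@big_cat_nat _ _ _ j)//=; last exact: ltnW.
rewrite [X in _ + X]big_ltn// ltnn (_ : minn _ _ - _ = 0)%N; last lia.
rewrite expr0 addrCA addrA; congr (_ + _ + _).
  case: ifP => [/eqP->|/negbT j0]; first by rewrite big_geq.
  rewrite big_ltn ?lt0n// j0 max0n addrC /one_side; congr (_ + _).
  (* Exponents on the left decrease with the index, hence the reversal. *)
  rewrite [LHS]big_nat_rev; apply: eq_big_nat => i ij.
  by rewrite ifT; [congr (_ ^+ _); lia|lia].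
case: ifP => [/eqP jE|/negbT jN1]; first by rewrite big_geq// jE; lia.
rewrite -[X in \sum_(_ <= _ < X) _](prednK (ltnW N_ge2)) big_nat_recr /=; last lia.
rewrite /one_side ifF; last lia.
congr (_ + _ ^+ _); last lia.
rewrite -[X in \sum_(X <= _ < _) _]addn1 addnC big_addn.
by apply: eq_big_nat => i ij; rewrite ifF; [congr (_ ^+ _); lia|lia].
Qed.

(** In [h] the term [l = 0] is the seed, and the separate 1 of the second case is a side with a
    single agent. *)
Lemma hE (R : realType) N (j : 'I_N) (p : R) : (2 <= N)%N ->
  h N j.+1 p = \sum_(i < N) p ^+ #|bottlenecks j i|.
Proof.
move=> N_ge2; rewrite sum_bottlenecks// /h; have jN := ltn_ord j.
have sum0 a : \sum_(0 <= l < a.+1) p ^+ l = 1 + \sum_(1 <= l < a.+1) p ^+ l.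
  by rewrite big_ltn// expr0.
have side1 : one_side p 1 = 1 by rewrite /one_side big_geq// add0r.
have sideE a b : a = b.+1 -> one_side p a = \sum_(1 <= l < b.+1) p ^+ l + p ^+ b.
  by move=> ->; rewrite /one_side subn1.
have [j0|j0] := eqVneq (j : nat) 0%N.
  rewrite j0 /= ifF; last lia.
  by rewrite (sideE _ (N - 2)%N) ?sum0 ?subn0; [ring|lia].
have [jN1|jN1] := eqVneq (j : nat) N.-1.
  rewrite ifT; last lia.
  by rewrite (sideE j (N - 2)%N) ?sum0 /=; [ring|lia].
rewrite (_ : _ || _ = false); last by lia.
have [j1|j1] := eqVneq (j : nat) 1%N.
  by rewrite j1 /= side1 (sideE _ (N - 3)%N) ?sum0 /=; [ring|lia].
have [jN2|jN2] := eqVneq (j : nat) (N - 2)%N.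
  rewrite ifT; last lia.
  have -> : (N.-1 - j = 1)%N by lia.
  by rewrite side1 (sideE j (N - 3)%N) ?sum0 /=; [ring|lia].
rewrite (_ : _ || _ = false); last by lia.
rewrite (sideE j (j.+1 - 2)%N); last lia.
by rewrite (sideE (N.-1 - j)%N (N - j.+1 - 1)%N) ?sum0; [ring|lia].
Qed.

(** * Strict monotonicity and comparison of the models *)

Lemma ler_one_side (R : realDomainType) (p q : R) a :
  0 <= p -> p <= q -> one_side p a <= one_side q a.
Proof.
move=> p0 pq; apply: lerD; last by rewrite lerXn2r ?nnegrE// (le_trans p0).
by apply: ler_sum => i _; rewrite lerXn2r ?nnegrE// (le_trans p0).
Qed.

Lemma ltr_one_side (R : realDomainType) (p q : R) a : (2 <= a)%N ->
  0 <= p -> p < q -> one_side p a < one_side q a.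
Proof.
move=> a2 p0 pq; rewrite /one_side; apply: ler_ltD.
  by apply: ler_sum => i _; rewrite lerXn2r ?nnegrE ?(ltW pq)// (le_trans p0)// ltW.
by rewrite ltrXn2r ?pq ?(le_lt_trans p0)//; lia.
Qed.

(** Strictness comes from a side with at least two agents. For [N = 2], or a seed in the middle of
    three agents, all others are ends beside the seed and [h] is constant. *)
Lemma ltr_h (R : realType) N (j : 'I_N) (p q : R) : (3 <= N)%N ->
  ~ (N = 3%N /\ j.+1 = 2%N) -> 0 <= p -> p < q -> h N j.+1 p < h N j.+1 q.
Proof.
move=> N3 Nj p0 pq; have jN := ltn_ord j.
rewrite !hE ?sum_bottlenecks ?(ltnW N3)// -!addrA ltrD2l.
have [jE|j0] := eqVneq (j : nat) 0%N.
  rewrite jE /= !add0r (_ : (0 == N.-1)%N = false); last by lia.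
  by apply: ltr_one_side => //; lia.
rewrite /=; case: ifP => [/eqP jE|jN1]; first by rewrite !addr0 ltr_one_side//; lia.
(* The left side has [j] agents; if [j] is 1, the right side has [N - 2], at least two since [N = 3]
   is excluded there. *)
have [j2|j2] := leqP 2 j.
  by rewrite ltr_leD ?ltr_one_side ?ler_one_side// ltW.
apply: ler_ltD; first by apply: ler_one_side => //; exact: ltW.
by apply: ltr_one_side => //; lia.
Qed.

Theorem proposition1 (R : realType) (N : nat) (hN : (2 <= N)%N) (j : 'I_N)
    (d1 : measure_display) (T1 : measurableType d1) (P1 : probability T1 R)
    (mu1 : 'I_N -> 'I_1 -> {RV P1 >-> R}) (u1 : 'I_N -> protocol)
    (d2 : measure_display) (T2 : measurableType d2) (P2 : probability T2 R)
    (mu2 : 'I_N -> 'I_2 -> {RV P2 >-> R})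
    (hmu1 : iid_uniform_thresholds mu1) (hmu2 : iid_uniform_thresholds mu2) :
  let C_Pa := cascade_centrality (path_monoplex N) u1 mu1 j in
  let C_OR := cascade_centrality (repeated_path_duplex N) (fun=> OR) mu2 j in
  let C_AND := cascade_centrality (repeated_path_duplex N) (fun=> AND) mu2 j in
  [/\ C_Pa = (h N j.+1 (1 / 2 : R))%:E,
      C_OR = (h N j.+1 (3 / 4 : R))%:E,
      C_AND = (h N j.+1 (1 / 4 : R))%:E
    & ((3 <= N)%N -> ~ (N = 3%N /\ j.+1 = 2%N) ->
       (C_OR > C_Pa)%E /\ (C_Pa > C_AND)%E)].
Proof.
move=> C_Pa C_OR C_AND.
have PaE : C_Pa = (h N j.+1 (1 / 2 : R))%:E.
  rewrite /C_Pa path_centralityE// hE//; congr EFin; apply: eq_bigr => i _.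
  rewrite (eq_bigr (fun=> 1 / 2)) ?prodr_const// => l _.
  (* With one layer both protocols respond with probability 1/2. *)
  by case: (u1 l) => /=; lra.
have ORE : C_OR = (h N j.+1 (3 / 4 : R))%:E.
  rewrite /C_OR path_centralityE// hE//; congr EFin; apply: eq_bigr => i _.
  by rewrite prodr_const; congr (_ ^+ _) => /=; lra.
have ANDE : C_AND = (h N j.+1 (1 / 4 : R))%:E.
  rewrite /C_AND path_centralityE// hE//; congr EFin; apply: eq_bigr => i _.
  by rewrite prodr_const; congr (_ ^+ _) => /=; lra.
split=> // N3 Nj; rewrite PaE ORE ANDE !lte_fin.
by split; apply: ltr_h => //; lra.
Qed.
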